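(* Let $J$ be a Jordan algebra over a field $F$ with a decomposition $J = J_1 \oplus J_2$, where $J_1, J_2$ are ideals of $J$. Then: (1) $C(J) = C(J_1) \dotplus C(J_2)$; (2) if $C(J) = \{0\}$, then $\mathrm{Der}(J) = \mathrm{Der}(J_1) \oplus \mathrm{Der}(J_2)$.
   Context: A Jordan algebra over a field $F$ is an $F$-algebra $J$ with product $\circ$ such that $x\circ y = y\circ x$ and $(x^2\circ y)\circ x = x^2\circ(x\circ y)$ for all $x,y\in J$, where $x^2 = x\circ x$. The center of a Jordan algebra $J$ is $C(J) = \{a\in J \mid (a\circ x)\circ y = (a\circ y)\circ x = (x\circ y)\circ a \ \ \forall x,y\in J\}$. A derivation of $J$ is a linear map $D:J\to J$ with $D(x\circ y) = D(x)\circ y + x\circ D(y)$ for all $x,y\in J$; $\mathrm{Der}(J)$ is the Lie algebra of all derivations under the commutator bracket $[D,D']=DD'-D'D$. The symbol $\dotplus$ denotes direct sum of vector subspaces, and $\oplus$ denotes direct sum of ideals. For $i\neq j$ in $\{1,2\}$, a linear map $D:J_i\to J_i$ is identified with its extension to $J$ that vanishes on $J_j$; in this way $\mathrm{Der}(J_i)$ is regarded as a set of linear maps on $J$. *)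

(* Defs.v *)
From HB Require Import structures.
From mathcomp Require Import all_boot all_order all_algebra.
From mathcomp Require Import all_classical.

Set Implicit Arguments.
Unset Strict Implicit.
Unset Printing Implicit Defensive.

Import GRing.Theory.
Local Open Scope classical_set_scope.
Local Open Scope ring_scope.

(* No restriction on the characteristic or the dimension, and no unit. *)
HB.mixin Record Lmodule_isJordan (F : fieldType) J of GRing.Lmodule F J := {
  jmul : J -> J -> J;
  jmul_bilinear : bilinear_for *:%R *:%R jmul;
  jmulC : commutative jmul;
  jordan_identity : forall x y : J,
    jmul (jmul (jmul x x) y) x = jmul (jmul x x) (jmul x y)
}.

#[short(type="jordanAlgType")]
HB.structure Definition JordanAlgebra (F : fieldType) :=
  { J of Lmodule_isJordan F J & GRing.Lmodule F J }.

Definition is_subspace (F : fieldType) (V : lmodType F) (A : set V) : Prop :=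
  submod_closed (mem A).

Definition direct_sum (F : fieldType) (V : lmodType F) (A B C : set V) : Prop :=
  [/\ is_subspace B, is_subspace C,
      A = [set b + c | b in B & c in C] & B `&` C = [set 0]].

(* Here A, stable under op, is the algebra in which I is an ideal; op need not
   be commutative (it is a product in J, and a Lie bracket in Der(J)). *)
Definition is_ideal (F : fieldType) (V : lmodType F) (op : V -> V -> V)
    (A I : set V) : Prop :=
  [/\ I `<=` A, is_subspace I
    & forall a x, A a -> I x -> I (op a x) /\ I (op x a)].

Definition ideal_direct_sum (F : fieldType) (V : lmodType F)
    (op : V -> V -> V) (A B C : set V) : Prop :=
  [/\ is_ideal op A B, is_ideal op A C & direct_sum A B C].

Record jideal (F : fieldType) (J : jordanAlgType F) := JIdeal {
  jset :> set J;
  jset_ideal : is_ideal (@jmul F J) [set: J] jset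
}.

Definition ideal_alg (F : fieldType) (J : jordanAlgType F) (I : jideal J)
  : Type := {x : J | x \in jset I}.

Section IdealAlgebra.
Variables (F : fieldType) (J : jordanAlgType F) (I : jideal J).

HB.instance Definition _ := SubChoice.on (ideal_alg I).

Fact ideal_submod_closed : submod_closed (mem (jset I)).
Proof. by case: (jset_ideal I). Qed.

HB.instance Definition _ :=
  GRing.SubChoice_isSubLmodule.Build F J _ (ideal_alg I) ideal_submod_closed.

Fact ideal_jmul_in (x y : ideal_alg I) : jmul (val x) (val y) \in jset I.
Proof.
case: (jset_ideal I) => _ _ h; rewrite inE.
by case: (h (val x) (val y)) => //; apply: set_mem; exact: valP.
Qed.

Definition ideal_jmul (x y : ideal_alg I) : ideal_alg I :=
  Sub (jmul (val x) (val y)) (ideal_jmul_in x y).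

Fact ideal_jmul_bilinear : bilinear_for *:%R *:%R ideal_jmul.
Proof.
have [hl hr] := @jmul_bilinear F J.
split=> u a x y; apply: val_inj; rewrite linearP /=.
  exact: hl.
exact: hr.
Qed.

Fact ideal_jmulC : commutative ideal_jmul.
Proof. by move=> x y; apply: val_inj; rewrite /= jmulC. Qed.

Fact ideal_jordan_identity (x y : ideal_alg I) :
  ideal_jmul (ideal_jmul (ideal_jmul x x) y) x
  = ideal_jmul (ideal_jmul x x) (ideal_jmul x y).
Proof. by apply: val_inj; rewrite /= jordan_identity. Qed.

HB.instance Definition _ := Lmodule_isJordan.Build F (ideal_alg I)
  ideal_jmul_bilinear ideal_jmulC ideal_jordan_identity.

End IdealAlgebra.

Definition center (F : fieldType) (J : jordanAlgType F) : set J :=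
  [set a | forall x y : J,
     jmul (jmul a x) y = jmul (jmul a y) x
     /\ jmul (jmul a y) x = jmul (jmul x y) a].
Arguments center {F} J _.

(* Der(J) lives in the vector space J -> J of all maps, with pointwise
   operations. *)
Definition Der (F : fieldType) (J : jordanAlgType F) : set (J -> J) :=
  [set D | linear D
     /\ forall x y : J, D (jmul x y) = jmul (D x) y + jmul x (D y)].
Arguments Der {F} J _.

Definition commutator (V : zmodType) (D E : V -> V) : V -> V :=
  (D \o E) - (E \o D).

Fact Der_commutator (F : fieldType) (J : jordanAlgType F) (D E : J -> J) :
  Der J D -> Der J E -> Der J (commutator D E).
Proof.
have [hl hr] := @jmul_bilinear F J.
move=> [lD dD] [lE dE].
have aD u v : D (u + v) = D u + D v by have := lD 1 u v; rewrite !scale1r.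
have aE u v : E (u + v) = E u + E v by have := lE 1 u v; rewrite !scale1r.
have mBl (u v w : J) : jmul (u - v) w = jmul u w - jmul v w.
  by have := hl w (-1) v u; rewrite /= !scaleN1r ![- _ + _]addrC.
have mBr (u v w : J) : jmul w (u - v) = jmul w u - jmul w v.
  by rewrite !(jmulC w) mBl.
have cE (x : J) : commutator D E x = D (E x) - E (D x) by [].
split; [move=> a u v | move=> x y]; rewrite !cE.
  by rewrite lE lD lD lE scalerBr opprD addrACA.
have alg (a b c d e f : J) :
    (a + b + (c + d)) - (e + c + (b + f)) = a - e + (d - f).
  rewrite (addrC a) addrACA (addrC e) (addrACA c) (addrC c b).
  by rewrite opprD [LHS]addrACA subrr add0r opprD addrACA.
by rewrite dE dD aD aE !dD !dE mBl mBr alg.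
Qed.

(* E is the extension of D by zero on K; extension_by_zero below shows that it
   exists and is unique when J is the direct sum of I and K. *)
Definition extends_by_zero (F : fieldType) (J : jordanAlgType F)
    (I K : jideal J) (D : ideal_alg I -> ideal_alg I) (E : J -> J) : Prop :=
  [/\ linear E, forall x : ideal_alg I, E (val x) = val (D x)
    & forall y : J, jset K y -> E y = 0].

(* Der(I) regarded as a set of linear maps on J vanishing on K *)
Definition Der_ext (F : fieldType) (J : jordanAlgType F) (I K : jideal J)
  : set (J -> J) :=
  [set E | exists2 D, Der (ideal_alg I) D & extends_by_zero K D E].

Definition center_in (F : fieldType) (J : jordanAlgType F) (I : jideal J)
  : set J :=
  [set val a | a in center (ideal_alg I)].

Fact extension_by_zero (F : fieldType) (J : jordanAlgType F) (I K : jideal J)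
    (D : ideal_alg I -> ideal_alg I) :
  direct_sum [set: J] I K -> linear D ->
  exists! E : J -> J, extends_by_zero K D E.
Proof.
move=> [_ _ hJ hI] linD.
have dec y : exists p : ideal_alg I * J, jset K p.2 /\ val p.1 + p.2 = y.
  have : [set: J] y by [].
  rewrite hJ => -[b Ib [c Kc <-]].
  by exists (Sub b (mem_set Ib), c).
have [_ [/set_mem K0 Klin] _] := jset_ideal K.
have KP a u v : jset K u -> jset K v -> jset K (a *: u + v).
  by move=> Ku Kv; apply/set_mem/Klin; exact: mem_set.
have uniq (x x' : ideal_alg I) z z' :
    jset K z -> jset K z' -> val x + z = val x' + z' -> x = x' /\ z = z'.
  move=> Kz Kz' e.
  have e1 : val (x - x') = z' - z.
    have ex : val x = val x' + z' - z by rewrite -e addrK.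
    by rewrite raddfB /= ex (addrC (val x')) addrAC addrK.
  have /eqP : val (x - x') = 0.
    have : (jset I `&` jset K) (val (x - x')).
      split; first by apply: set_mem; exact: valP.
      by rewrite e1 addrC -scaleN1r; exact: KP.
    by rewrite hI.
  rewrite raddfB subr_eq0 => /eqP /val_inj ex; split=> //.
  by move: e; rewrite ex => /addrI.
pose p y := projT1 (cid (dec y)).
have pP y : jset K (p y).2 /\ val (p y).1 + (p y).2 = y by rewrite /p; case: cid.
have pE (x : ideal_alg I) z : jset K z -> (p (val x + z)).1 = x.
  by move=> Kz; have [Kp e] := pP (val x + z); have [] := uniq _ _ _ _ Kp Kz e.
exists (fun y => val (D (p y).1)); split.
  split.
  - move=> a u v /=.
    have [Ku eu] := pP u; have [Kv ev] := pP v.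
    have -> : a *: u + v =
        val (a *: (p u).1 + (p v).1) + (a *: (p u).2 + (p v).2).
      by rewrite -{1}eu -{1}ev linearP scalerDr addrACA.
    by rewrite pE ?linD ?linearP //; exact: KP.
  - by move=> x; rewrite -[val x]addr0 pE.
  - move=> y Ky; rewrite -[y]add0r.
    have D0 : D 0 = 0.
      by have := linD (-1) 0 0; rewrite scaler0 addr0 /= scaleN1r addNr.
    by rewrite -(raddf0 (val : ideal_alg I -> J)) pE // D0 raddf0.
move=> E [linE EI EK]; apply/funext => y.
have [Ky ey] := pP y.
have := linE 1 (val (p y).1) (p y).2.
by rewrite !scale1r ey EI (EK _ Ky) addr0 => ->.
Qed.

(* Main.v *)
Require Import Defs.
From mathcomp Require Import all_boot all_order all_algebra.
From mathcomp Require Import all_classical.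

Set Implicit Arguments.
Unset Strict Implicit.
Unset Printing Implicit Defensive.

Import GRing.Theory.
Local Open Scope classical_set_scope.
Local Open Scope ring_scope.

(** The projection [p] of [J] onto an ideal summand satisfies
    [p (x y) = (p x) y].  Hence the components of a central element are
    central.  If [x] lies in [J1] and [v] is the [J2]-component of [D x], then
    projecting [0 = D (x y) = (D x) y + x (D y)], for [y] in [J2], to [J2]
    gives [v y = 0]; so [v] annihilates [J] and is central.  When the center
    is trivial, every derivation therefore preserves both summands. *)

(** * Subspaces and linear maps given as predicates *)

Lemma is_subspaceP (F : fieldType) (V : lmodType F) (A : set V) :
  is_subspace A <->
  A 0 /\ (forall (a : F) (u v : V), A u -> A v -> A (a *: u + v)).
Proof.
split=> [[/set_mem A0 Alin]|[A0 Alin]]; split=> //.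
- by move=> a u v Au Av; apply/set_mem/Alin; exact: mem_set.
- exact: mem_set.
- by move=> a u v /set_mem Au /set_mem Av; apply/mem_set/Alin.
Qed.

Lemma subspace0 (F : fieldType) (V : lmodType F) (A : set V) :
  is_subspace A -> A 0.
Proof. by move=> /is_subspaceP[]. Qed.

Lemma subspaceD (F : fieldType) (V : lmodType F) (A : set V) (u v : V) :
  is_subspace A -> A u -> A v -> A (u + v).
Proof.
by move=> /is_subspaceP[_ AD] Au Av; have := AD 1 u v Au Av; rewrite scale1r.
Qed.

Lemma subspaceB (F : fieldType) (V : lmodType F) (A : set V) (u v : V) :
  is_subspace A -> A u -> A v -> A (u - v).
Proof.
by move=> /is_subspaceP[_ AD] Au Av; rewrite addrC -scaleN1r; exact: AD.
Qed.

Lemma linear_subE (F : fieldType) (V W : lmodType F) (f : V -> W) :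
  linear f -> forall u v, f (u - v) = f u - f v.
Proof. by move=> lf u v; rewrite addrC -scaleN1r lf scaleN1r addrC. Qed.

Lemma linear_0E (F : fieldType) (V W : lmodType F) (f : V -> W) :
  linear f -> f 0 = 0.
Proof. by move=> lf; rewrite -[X in f X](subrr 0) (linear_subE lf) subrr. Qed.

(** * Linearity of the Jordan product; the center and the derivations as subspaces *)

Section JordanProduct.
Variables (F : fieldType) (J : jordanAlgType F).
Implicit Types (a : F) (x y z u v : J) (I : jideal J).

Lemma jmulPl a u v z : jmul (a *: u + v) z = a *: jmul u z + jmul v z.
Proof. exact: (jmul_bilinear (s := J)).1. Qed.

Lemma jmulPr a u v z : jmul z (a *: u + v) = a *: jmul z u + jmul z v.
Proof. exact: (jmul_bilinear (s := J)).2. Qed.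

Lemma jmulBl u v z : jmul (u - v) z = jmul u z - jmul v z.
Proof.
exact: (@linear_subE _ _ _ (jmul^~ z) (fun a u v => jmulPl a u v z)).
Qed.

Lemma jmul0l z : jmul 0 z = 0.
Proof. by rewrite -[X in jmul X _](subrr 0) jmulBl subrr. Qed.

Lemma jmul0r z : jmul z 0 = 0.
Proof. by rewrite jmulC jmul0l. Qed.

Lemma jideal_subspace I : is_subspace (jset I).
Proof. by case: (jset_ideal I). Qed.

Lemma jidealM I x y : jset I x -> jset I (jmul x y).
Proof. by case: (jset_ideal I) => _ _ h Ix; case: (h y x). Qed.

Lemma center_subspace : is_subspace (center J).
Proof.
apply/is_subspaceP; split=> [x y|a u v cu cv x y].
  by rewrite !(jmul0l, jmul0r).
have [u1 u2] := cu x y; have [v1 v2] := cv x y.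
by rewrite !(jmulPl, jmulPr) u1 v1 u2 v2.
Qed.

Lemma annihilator_central v : (forall y, jmul v y = 0) -> center J v.
Proof. by move=> v0 x y; rewrite (jmulC _ v) !v0 !jmul0l. Qed.

Lemma Der_subspace : is_subspace (Der J).
Proof.
have addE (D E : J -> J) a x : (a *: D + E) x = a *: D x + E x by [].
apply/is_subspaceP; split=> [|a D E [lD dD] [lE dE]].
  have zE x : (0 : J -> J) x = 0 by [].
  by split=> [a u v|x y]; rewrite !zE ?scaler0 ?jmul0l ?jmul0r addr0.
split=> [b u v|x y]; rewrite !addE.
  by rewrite lD lE !scalerDr !scalerA addrACA (mulrC a).
by rewrite dD dE jmulPl jmulPr scalerDr addrACA.
Qed.

End JordanProduct.

(** * Projection onto an ideal summand *)

Definition ideal_projection {F : fieldType} {J : jordanAlgType F}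
    (I K : jideal J) (p : J -> J) : Prop :=
  [/\ linear p, forall y, jset I (p y), forall y, jset K (y - p y),
      forall x, jset I x -> p x = x & forall y, jset K y -> p y = 0].

(** The projection is the extension by zero of the identity of [I]. *)
Lemma direct_sum_projection (F : fieldType) (J : jordanAlgType F)
    (I K : jideal J) :
  direct_sum [set: J] I K -> exists p : J -> J, ideal_projection I K p.
Proof.
move=> hIK; have [_ _ hJ _] := hIK.
have lid : linear (id : ideal_alg I -> ideal_alg I) by [].
have [p [[lp pI pK] _]] := extension_by_zero hIK lid.
have pid x : jset I x -> p x = x.
  by move=> Ix; exact: (pI (Sub x (mem_set Ix))).
have dec y : exists b c, [/\ jset I b, jset K c, y = b + c & p y = b].
  have : [set: J] y by [].
  rewrite hJ => -[b Ib [c Kc <-]]; exists b, c; split=> //.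
  by have := lp 1 b c; rewrite !scale1r (pid b) // (pK c) // addr0.
exists p; split=> // y; have [b [c [Ib Kc -> ->]]] := dec y => //.
by rewrite addrC addrA addNr add0r.
Qed.

(** This symmetry carries every result about one summand over to the other. *)
Lemma ideal_projectionC (F : fieldType) (J : jordanAlgType F)
    (I K : jideal J) (p : J -> J) :
  ideal_projection I K p -> ideal_projection K I (fun y => y - p y).
Proof.
move=> [lp Ip Kp pid p0]; split=> // [a u v|y|x Kx|y Iy].
- by rewrite lp scalerBr opprD addrACA.
- by rewrite subKr.
- by rewrite p0 // subr0.
- by rewrite pid // subrr.
Qed.

(** * Center and derivations of a summand, seen inside [J] *)

Section Projection.
Variables (F : fieldType) (J : jordanAlgType F) (I K : jideal J) (p : J -> J).
Hypothesis hp : ideal_projection I K p.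
Implicit Types (x y : J) (D E : J -> J).

(** The difference [jmul (x - p x) y] lies in the ideal [K], so [p] kills it, while [jmul (p x) y]
    lies in [I] and is fixed by [p]. *)
Lemma projM x y : p (jmul x y) = jmul (p x) y.
Proof.
have [lp Ip Kp pid p0] := hp.
have := linear_subE lp (jmul x y) (jmul (p x) y).
rewrite -jmulBl p0; last exact: jidealM.
by move/esym/subr0_eq => ->; rewrite pid //; exact: jidealM.
Qed.

Lemma projMr x y : p (jmul x y) = jmul x (p y).
Proof. by rewrite jmulC projM jmulC. Qed.

Lemma projMM x y : p (jmul x y) = jmul (p x) (p y).
Proof.
have [_ Ip _ pid _] := hp.
by rewrite -projM -projMr [RHS]pid.
Qed.

Lemma jmul_projr x y : jset I x -> jmul x y = jmul x (p y).
Proof. by have [_ _ _ pid _] := hp => Ix; rewrite -projMr projM pid. Qed.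

Lemma center_proj x : center J x -> center J (p x).
Proof.
move=> cx y z; have [e1 e2] := cx y z.
by rewrite -!(projM, projMr) e1 e2.
Qed.

(** This replaces the center of the subtype by a condition in [J]. Multiplying an element of [I] by
    [y] only involves [p y], so centrality tested on [I] extends to all of [J]. *)
Lemma center_inE : center_in I = [set x | jset I x /\ center J x].
Proof.
have [lp Ip Kp pid p0] := hp.
apply/seteqP; split=> [_ [b cb <-]|x [Ix cx]].
  have Ib : jset I (val b) by apply: set_mem; exact: valP.
  have bE x : jmul (val b) x = jmul (val b) (p x) by exact: jmul_projr.
  split=> // x y.
  have [/(congr1 val) e1 /(congr1 val) e2] :=
    cb (Sub (p x) (mem_set (Ip x))) (Sub (p y) (mem_set (Ip y))).
  have IE u v : jmul (jmul (val b) u) v = jmul (jmul (val b) (p u)) (p v).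
    by rewrite -bE; apply: jmul_projr; exact: jidealM.
  have -> : jmul (jmul x y) (val b) = jmul (jmul (p x) (p y)) (val b).
    by rewrite jmulC bE projMM jmulC.
  by rewrite (IE x y) (IE y x); split.
exists (Sub x (mem_set Ix)) => // y z.
by have [e1 e2] := cx (val y) (val z); split; exact: val_inj.
Qed.

Lemma center_in_subspace : is_subspace (center_in I).
Proof.
have [I0 ID] := (is_subspaceP _).1 (jideal_subspace I).
have [C0 CD] := (is_subspaceP _).1 (center_subspace J).
rewrite center_inE; apply/is_subspaceP.
by split=> // a u v [Iu Cu] [Iv Cv]; split; auto.
Qed.

(** Members of [Der_ext] become derivations of [J] itself, so that later arguments avoid the
    subtype. *)
Lemma Der_extE : Der_ext I K =
  [set E | [/\ Der J E, forall x, jset I x -> jset I (E x)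
    & forall y, jset K y -> E y = 0]].
Proof.
have [lp Ip Kp pid p0] := hp.
apply/seteqP; split=> [E [D [lD dD] [lE EI EK]]|E [[lE dE] EI EK]].
  have EIE x : jset I x -> exists2 d : ideal_alg I, val d = x & E x = val (D d).
    by move=> Ix; exists (Sub x (mem_set Ix)) => //; rewrite -EI.
  have Ip' x : jset I x -> jset I (E x).
    by move=> /EIE [d _ ->]; apply: set_mem; exact: valP.
  (* [E] kills [x - p x], so it factors through [p]; the Leibniz rule on [J] then reduces to that of
     [D] on [I]. *)
  have Ep x : E x = E (p x).
    by apply: subr0_eq; rewrite -(linear_subE lE) EK.
  split=> //; split=> // x y.
  rewrite (Ep x) (Ep y) (jmul_projr y (Ip' _ (Ip x))) (jmulC x (E _)).
  rewrite (jmul_projr x (Ip' _ (Ip y))) -(jmulC (p x)).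
  have -> : E (jmul x y) = E (jmul (p x) (p y)) by rewrite Ep projMM.
  have [d <- ->] := EIE _ (Ip x); have [e <- ->] := EIE _ (Ip y).
  have -> : jmul (val d) (val e) = val (jmul d e) by [].
  by rewrite EI dD raddfD.
have EJ (x : ideal_alg I) : E (val x) \in jset I.
  by apply/mem_set/EI/set_mem; exact: valP.
pose D (x : ideal_alg I) : ideal_alg I := Sub (E (val x)) (EJ x).
have DE (x : ideal_alg I) : val (D x) = E (val x) by [].
exists D; last by split.
split=> [a u v|x y]; apply: val_inj; first by rewrite linearP !DE linearP lE.
by rewrite raddfD !DE /= dE.
Qed.

Lemma Der_ext_subspace : is_subspace (Der_ext I K).
Proof.
have [_ ID] := (is_subspaceP _).1 (jideal_subspace I).
have [D0 DD] := (is_subspaceP _).1 (Der_subspace J).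
have addE (D E : J -> J) (a : F) x : (a *: D + E) x = a *: D x + E x by [].
rewrite Der_extE; apply/is_subspaceP; split.
  by split=> // x _; exact: subspace0 (jideal_subspace I).
move=> a D E [dD DI D_0] [dE EI E_0]; split; first exact: DD.
  by move=> x Ix; rewrite addE; apply: ID; auto.
by move=> y Ky; rewrite addE D_0 // E_0 // scaler0 addr0.
Qed.

(** It suffices that the [I]-component [p (D x)] annihilates [J], since it is then central, hence
    zero. *)
Lemma Der_stable_compl D : center J = [set 0] -> Der J D ->
  forall x, jset K x -> jset K (D x).
Proof.
move=> cJ [lD dD] x Kx.
have [lp Ip Kp pid p0] := hp.
have px0 z : p (jmul x z) = 0 by rewrite projM p0 // jmul0l.
have pDx0 : p (D x) = 0.
  suff : center J (p (D x)) by rewrite cJ.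
  apply: annihilator_central => y.
  (* Taking [p y] for an arbitrary [y] makes [jmul x (p y)] vanish. Applying [p] to the Leibniz rule
     also kills [jmul x (D (p y))], which leaves [jmul (p (D x)) y = 0]. *)
  have := dD x (p y).
  rewrite -projMr px0 (linear_0E lD) => /(congr1 (fun z => p (z - jmul x (D (p y))))).
  rewrite addrK (linear_subE lp) px0 subr0 projM -jmul_projr // => <-.
  by rewrite p0 //; exact: subspace0 (jideal_subspace K).
by rewrite -[D x]subr0 -pDx0.
Qed.

End Projection.

(** * Derivations when the center is trivial *)

Section Derivations.
Variables (F : fieldType) (J : jordanAlgType F) (I K : jideal J) (p : J -> J).
Hypotheses (hp : ideal_projection I K p) (cJ : center J = [set 0]).
Implicit Types (x y : J) (D E : J -> J).

Lemma Der_stable D : Der J D -> forall x, jset I x -> jset I (D x).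
Proof.
by move=> dD x; exact: (Der_stable_compl (ideal_projectionC hp) cJ dD).
Qed.

(** Since [D] preserves both summands, both commutators of [D] and [E] preserve [I], and they vanish
    on [K] because [E] kills [y] as well as [D y]. *)
Lemma Der_ext_ideal : is_ideal (@commutator J) (Der J) (Der_ext I K).
Proof.
rewrite (Der_extE hp); split; [by move=> E []| |].
  by rewrite -(Der_extE hp); exact: (Der_ext_subspace hp).
have IB x y := @subspaceB _ _ _ x y (jideal_subspace I).
have cE D E x : commutator D E x = D (E x) - E (D x) by [].
move=> D E dD [dE EI E0]; have DI := Der_stable dD.
have DK := Der_stable_compl hp cJ dD.
have D0 : D 0 = 0 by apply: linear_0E; case: dD.
by split; split=> [|x Ix|y Ky]; try (by apply: Der_commutator);
  rewrite cE ?(E0 y) ?(E0 (D y)) ?D0 ?subrr; auto.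
Qed.

(** As [p] is multiplicative, the Leibniz rule for [D] at [p x] and [p y] applies; [D (p x)] stays
    in [I], so its product with [p y] equals its product with [y]. *)
Lemma Der_restrict_ext D : Der J D -> Der_ext I K (D \o p).
Proof.
have [lp Ip Kp pid p0] := hp.
move=> dD; have DI := Der_stable dD.
have [lD mD] := dD.
have D0 := linear_0E lD.
rewrite (Der_extE hp); split=> [|x _|y Ky] /=.
- split=> [a u v|x y] /=; first by rewrite lp lD.
  rewrite (projMM hp) mD (jmul_projr hp y (DI _ (Ip x))) (jmulC x).
  by rewrite (jmul_projr hp x (DI _ (Ip y))) (jmulC (p x)).
- exact: DI.
- by rewrite p0.
Qed.

End Derivations.

(** * Decomposition of the center and of the derivation algebra *)

Theorem theorem2p2 (F : fieldType) (J : jordanAlgType F) (J1 J2 : jideal J)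
    (hJ : ideal_direct_sum (@jmul F J) [set: J] J1 J2) :
  direct_sum (center J) (center_in J1) (center_in J2)
  /\ (center J = [set 0] ->
      ideal_direct_sum (@commutator J) (Der J)
        (Der_ext J1 J2) (Der_ext J2 J1)).
Proof.
have [_ _ hds] := hJ.
have [p hp] := direct_sum_projection hds.
have hq := ideal_projectionC hp.
have [_ _ _ hI] := hds.
split=> [|cJ].
  have C1 := center_in_subspace hp; have C2 := center_in_subspace hq.
  split=> //; last first.
    apply/seteqP; split=> [x|x ->]; last by split; exact: subspace0.
    by rewrite (center_inE hp) (center_inE hq) -hI => -[[? _] [? _]].
  have [_ Ip Kp _ _] := hp.
  rewrite (center_inE hp) (center_inE hq).
  apply/seteqP; split=> [a ca|_ [b [_ cb] [c [_ cc] <-]]].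
    exists (p a); first by split; [|exact: (center_proj hp ca)].
    exists (a - p a); last by rewrite addrC subrK.
    by split; [|exact: (center_proj hq ca)].
  exact: (subspaceD (center_subspace J)).
split; [exact: (Der_ext_ideal hp cJ) | exact: (Der_ext_ideal hq cJ) |].
have S1 := Der_ext_subspace hp; have S2 := Der_ext_subspace hq.
split=> //; last first.
  apply/seteqP; split=> [D|D ->]; last by split; exact: subspace0.
  rewrite (Der_extE hp) (Der_extE hq) => -[[[lD _] _ D2] [_ _ D1]].
  have [_ Ip Kp _ _] := hp.
  (* A map in both summands kills [p x] and [x - p x], hence every [x]. *)
  apply/funext => x; apply: subr0_eq.
  rewrite subr0 -(subrK (p x) x) -[X in D (X + _)]scale1r lD.
  by rewrite D2 // D1 // scaler0 addr0.
apply/seteqP; split=> [D dD|_ [D + [E + <-]]].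
  (* By linearity [D] splits along [x = p x + (x - p x)]. *)
  exists (D \o p); first exact: (Der_restrict_ext hp cJ dD).
  exists (D \o (fun y => y - p y)); first exact: (Der_restrict_ext hq cJ dD).
  have [lD _] := dD.
  apply/funext => x.
  change (D (p x) + D (x - p x) = D x).
  by rewrite (linear_subE lD) addrC subrK.
rewrite (Der_extE hp) (Der_extE hq) => -[dD _ _] [dE _ _].
exact: (subspaceD (Der_subspace J)).
Qed.
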